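(* Let $M$ be a lightlike hypersurface of an indefinite statistical manifold $(\overline{M},\overline{g},\overline{\nabla},\overline{\nabla}^{*})$, with screen distribution $S(TM)$, radical distribution $\mathrm{Rad}(TM)$ spanned by $\xi$, and induced connections $\nabla$ and $\nabla^{*}$. Assume that both $\mathrm{Rad}(TM)$ and $S(TM)$ are parallel with respect to both $\nabla$ and $\nabla^{*}$. Let $R,R^{*},R^{0}$ be the curvature tensors of $\nabla,\nabla^{*},\nabla^{0}$. Then, for all $X,Y,Z\in\Gamma(TM)$, $$R(X,Y)PZ=P(R(X,Y)Z),\quad R^{*}(X,Y)PZ=P(R^{*}(X,Y)Z),\quad R^{0}(X,Y)PZ=P(R^{0}(X,Y)Z),$$ and $$R(X,Y)\xi=-2d\tau(X,Y)\xi,\qquad R^{*}(X,Y)\xi=-2d\tau^{*}(X,Y)\xi,\qquad R^{0}(X,Y)\xi=-\{d\tau(X,Y)+d\tau^{*}(X,Y)\}\xi.$$ Consequently, $R$, $R^{*}$ and $R^{0}$ preserve both $S(TM)$ and $\mathrm{Rad}(TM)$ (that is, for all $X,Y\in\Gamma(TM)$ the operators $R(X,Y)$, $R^{*}(X,Y)$, $R^{0}(X,Y)$ map each of these distributions into itself).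
   Context: $\Gamma(E)$ denotes smooth sections of $E$. An indefinite statistical manifold $(\overline{M},\overline{g},\overline{\nabla},\overline{\nabla}^{*})$ is a semi-Riemannian manifold $(\overline M,\overline g)$ with a torsion-free affine connection $\overline\nabla$ satisfying the Codazzi condition $(\overline{\nabla}_{X}\overline{g})(Y,Z)=(\overline{\nabla}_{Y}\overline{g})(X,Z)$, together with the dual connection $\overline\nabla^{*}$ determined by $X\overline{g}(Y,Z)=\overline{g}(\overline{\nabla}_{X}Y,Z)+\overline{g}(Y,\overline{\nabla}^{*}_{X}Z)$ (which is then also torsion-free). $M$ is a lightlike hypersurface: $M$ has codimension one and the induced metric $g$ is degenerate, so $\mathrm{Rad}(TM)=TM\cap TM^{\perp}=TM^{\perp}$ is a rank-one bundle. A screen distribution $S(TM)$ is a non-degenerate distribution complementary to $\mathrm{Rad}(TM)$ in $TM$; one is fixed, and $P$ is the projection of $TM$ onto $S(TM)$ along $\mathrm{Rad}(TM)$. Fix a nowhere-zero section $\xi$ of $\mathrm{Rad}(TM)$ (in general it exists only locally, and all objects depending on it are understood on its domain). $N$ is the unique vector field along $M$ with $\overline{g}(N,N)=0$, $\overline{g}(N,\xi)=1$, $\overline{g}(N,W)=0$ for all $W\in\Gamma(S(TM))$; then $T\overline M|_M=TM\oplus\mathrm{span}\{N\}$. For $X,Y\in\Gamma(TM)$ the Gauss formulas $\overline{\nabla}_{X}Y=\nabla_{X}Y+B(X,Y)N$ and $\overline{\nabla}^{*}_{X}Y=\nabla^{*}_{X}Y+B^{*}(X,Y)N$, with $\nabla_XY,\nabla^*_XY\in\Gamma(TM)$,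 define the induced torsion-free connections $\nabla,\nabla^{*}$; put $\nabla^{0}=\frac12(\nabla+\nabla^{*})$. The one-forms $\tau,\tau^{*}$ (and screen-valued operators $A_\xi,A_\xi^*:TM\to S(TM)$) are defined by $\nabla_{X}\xi=-A_{\xi}X-\tau(X)\xi$ and $\nabla^{*}_{X}\xi=-A^{*}_{\xi}X-\tau^{*}(X)\xi$. Conventions: $R(X,Y)Z=\nabla_X\nabla_YZ-\nabla_Y\nabla_XZ-\nabla_{[X,Y]}Z$, and analogously for $R^{*}$ (with $\nabla^{*}$) and $R^{0}$ (with $\nabla^{0}$); the exterior derivative is normalized by $2d\tau(X,Y)=X(\tau(Y))-Y(\tau(X))-\tau([X,Y])$, and analogously for $\tau^{*}$. A distribution $\mathcal D$ on $M$ is parallel with respect to a connection $D$ if $D_XY\in\Gamma(\mathcal D)$ for all $X\in\Gamma(TM)$, $Y\in\Gamma(\mathcal D)$. *)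

(* Defs.v *)
From HB Require Import structures.
From mathcomp Require Import all_boot all_order all_algebra.
From mathcomp Require Import all_classical all_reals all_analysis.

Set Implicit Arguments.
Unset Strict Implicit.
Unset Printing Implicit Defensive.

Import Order.TTheory GRing.Theory Num.Theory.
Import numFieldNormedType.Exports.

Local Open Scope classical_set_scope.
Local Open Scope ring_scope.

(* All objects on a manifold (functions, vector fields, connections) are total
   and carry an explicit open set on which they are required to be smooth;
   their values outside of it are irrelevant. This makes sections that exist
   only locally, such as a section of the radical, first-class. *)

(** * Smooth functions and manifolds *)

Fixpoint Ck (R : realType) (n k : nat) (A : set 'rV[R]_n)
    (f : 'rV[R]_n -> R) : Prop :=
  if k is k'.+1 then
    (forall x, A x -> differentiable f x) /\
    (forall v, Ck k' A (fun x => 'D_v f x))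
  else forall x, A x -> {for x, continuous f}.

Definition Cinfty (R : realType) (n : nat) (A : set 'rV[R]_n)
  (f : 'rV[R]_n -> R) : Prop := forall k, Ck k A f.

Record manifold (R : realType) (n : nat) := Manifold {
  carrier :> topologicalType ;
  chart : Type ;
  dom : chart -> set carrier ;
  coord : chart -> carrier -> 'rV[R]_n ;
  param : chart -> 'rV[R]_n -> carrier ;
  _ : hausdorff_space carrier ;
  _ : @second_countable carrier ;
  _ : forall p, exists a, dom a p ;
  _ : forall a, open (dom a) ;
  _ : forall a, open (coord a @` dom a) ;
  _ : forall a p, dom a p -> param a (coord a p) = p ;
  _ : forall a p, dom a p -> {for p, continuous (coord a)} ;
  _ : forall a x, (coord a @` dom a) x -> {for x, continuous (param a)} ;
  _ : forall a b (j : 'I_n),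
        Cinfty (coord a @` (dom a `&` dom b))
               (fun x => coord b (param a x) ord0 j) }.

Section Manifolds.
Variables (R : realType) (n : nat) (M : manifold R n).

Definition smooth_on (W : set M) (f : M -> R) : Prop :=
  forall a : chart M,
    Cinfty (coord a @` (W `&` dom a)) (fun x => f (param a x)).

Definition smooth_at (p : M) (f : M -> R) : Prop :=
  exists W, [/\ open W, W p & smooth_on W f].

(** * Tangent vectors and vector fields *)

(* A tangent vector is a derivation of the germs at p of smooth functions. It
   is represented by a function on all of M -> R, set to 0 off its natural
   domain, so that equality of tangent vectors is equality. *)
Definition dvec : Type := (M -> R) -> R^o.

Record tangent (p : M) (v : dvec) : Prop := Tangent {
  tangent_linear : forall (a : R) (f g : M -> R),
    smooth_at p f -> smooth_at p g ->
    v (fun x => a * f x + g x) = a * v f + v g ;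
  tangent_leibniz : forall f g : M -> R, smooth_at p f -> smooth_at p g ->
    v (fun x => f x * g x) = v f * g p + f p * v g ;
  tangent_germ : forall f g : M -> R, smooth_at p f ->
    (\forall x \near p, f x = g x) -> v f = v g ;
  tangent_junk : forall f : M -> R, ~ smooth_at p f -> v f = 0 }.

Definition vec_field : Type := M -> dvec.

End Manifolds.

Definition smooth_map (R : realType) (m n : nat) (M : manifold R m)
    (M' : manifold R n) (F : M -> M') : Prop :=
  continuous F /\
  forall (b : chart M') (j : 'I_n),
    smooth_on (F @^-1` dom b) (fun x => coord b (F x) ord0 j).

(* V is a smooth section over the open set W of the pull-back F^*(TM'). *)
Record vfield_along (R : realType) (m n : nat) (M : manifold R m)
    (M' : manifold R n) (F : M -> M') (W : set M) (V : M -> dvec M') : Prop :=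
  VfieldAlong {
    vfield_tangent : forall p, W p -> tangent (F p) (V p) ;
    vfield_smooth : forall (A : set M') (f : M' -> R), open A ->
      smooth_on A f -> smooth_on (W `&` F @^-1` A) (fun p => V p f) }.

Section VectorFields.
Variables (R : realType) (n : nat) (M : manifold R n).

Definition vfield (W : set M) (X : vec_field M) : Prop :=
  vfield_along (fun p : M => p) W X.

Definition bracket (X Y : vec_field M) : vec_field M := fun p f =>
  if `[< smooth_at p f >]
  then X p (fun q => Y q f) - Y p (fun q => X q f) else 0.

Record one_form (U : set M) (t : M -> dvec M -> R) : Prop := OneForm {
  one_form_linear : forall p (a : R) u v, U p -> tangent p u -> tangent p v ->
    t p (a *: u + v) = a * t p u + t p v ;
  one_form_smooth : forall W X, open W -> W `<=` U -> vfield W X ->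
    smooth_on W (fun p => t p (X p)) }.

(* Normalised by 2 d tau (X, Y) = X (tau Y) - Y (tau X) - tau [X, Y]. *)
Definition ext_d (t : M -> dvec M -> R) (X Y : vec_field M) (p : M) : R :=
  2^-1 * (X p (fun q => t q (Y q)) - Y p (fun q => t q (X q))
          - t p (bracket X Y p)).

(** * Connections *)

(* Covariant derivatives on the bundle whose local smooth sections over W are
   described by Gamma W. The operator acts on sections over every open set,
   compatibly with restriction (conn_local). *)
Record is_connection (E : lmodType R) (Gamma : set M -> (M -> E) -> Prop)
    (D : vec_field M -> (M -> E) -> (M -> E)) : Prop := IsConnection {
  conn_section : forall W X V, open W -> vfield W X -> Gamma W V ->
    Gamma W (D X V) ;
  conn_local : forall W X X' V V', open W ->
    vfield W X -> vfield W X' -> Gamma W V -> Gamma W V' ->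
    (forall p, W p -> X p = X' p) -> (forall p, W p -> V p = V' p) ->
    forall p, W p -> D X V p = D X' V' p ;
  conn_linear : forall W (f : M -> R) X X' V, open W -> smooth_on W f ->
    vfield W X -> vfield W X' -> Gamma W V ->
    forall p, W p ->
      D (fun q => f q *: X q + X' q) V p = f p *: D X V p + D X' V p ;
  conn_additive : forall W X V V', open W ->
    vfield W X -> Gamma W V -> Gamma W V' ->
    forall p, W p -> D X (fun q => V q + V' q) p = D X V p + D X V' p ;
  conn_leibniz : forall W (f : M -> R) X V, open W -> smooth_on W f ->
    vfield W X -> Gamma W V ->
    forall p, W p ->
      D X (fun q => f q *: V q) p = X p f *: V p + f p *: D X V p }.

Definition connection : Type := vec_field M -> vec_field M -> vec_field M.

Definition affine_connection (nabla : connection) : Prop :=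
  is_connection vfield nabla.

Definition torsion_free (nabla : connection) : Prop :=
  forall W X Y, open W -> vfield W X -> vfield W Y ->
  forall p, W p -> nabla X Y p - nabla Y X p = bracket X Y p.

Definition mean_connection (nabla nabla' : connection) : connection :=
  fun X Y p => 2^-1 *: (nabla X Y p + nabla' X Y p).

Definition curvature (nabla : connection) (X Y Z : vec_field M) : vec_field M :=
  fun p => nabla X (nabla Y Z) p - nabla Y (nabla X Z) p
           - nabla (bracket X Y) Z p.

(** * Distributions *)

Definition distribution (r : nat) (D : M -> set (dvec M)) : Prop :=
  forall p, exists (W : set M) (e : 'I_r -> vec_field M),
    [/\ open W, W p, (forall k, vfield W (e k)) &
      forall q, W q ->
        D q = [set \sum_(k < r) c k *: e k q | c in [set: 'I_r -> R]] /\
        (forall c : 'I_r -> R, \sum_(k < r) c k *: e k q = 0 ->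
           forall k, c k = 0)].

Definition dsection (D : M -> set (dvec M)) (W : set M) (X : vec_field M) :
  Prop := vfield W X /\ forall p, W p -> D p (X p).

Definition parallel (nabla : connection) (D : M -> set (dvec M)) : Prop :=
  forall W X Y, open W -> vfield W X -> dsection D W Y ->
    dsection D W (nabla X Y).

Definition curvature_preserves (nabla : connection) (D : M -> set (dvec M)) :
    Prop :=
  forall W X Y Z, open W -> vfield W X -> vfield W Y -> dsection D W Z ->
    dsection D W (curvature nabla X Y Z).

(** * Semi-Riemannian metrics and statistical structures *)

Definition bilinear_field : Type := M -> dvec M -> dvec M -> R.

Definition negative_definite_family (g : bilinear_field) (p : M) (r : nat)
    (e : 'I_r -> dvec M) : Prop :=
  (forall k, tangent p (e k)) /\
  forall c : 'I_r -> R, (exists k, c k != 0) ->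
    g p (\sum_(k < r) c k *: e k) (\sum_(k < r) c k *: e k) < 0.

(* q is the largest dimension of a negative definite subspace. *)
Definition has_index (g : bilinear_field) (p : M) (q : nat) : Prop :=
  (exists e : 'I_q -> dvec M, negative_definite_family g p e) /\
  (forall r (e : 'I_r -> dvec M), negative_definite_family g p e -> (r <= q)%N).

Record semi_riemannian (g : bilinear_field) : Prop := SemiRiemannian {
  metric_linear : forall p (a : R) u v w,
    tangent p u -> tangent p v -> tangent p w ->
    g p (a *: u + v) w = a * g p u w + g p v w ;
  metric_sym : forall p u v, tangent p u -> tangent p v -> g p u v = g p v u ;
  metric_nondegenerate : forall p u, tangent p u ->
    (forall v, tangent p v -> g p u v = 0) -> u = 0 ;
  metric_smooth : forall W X Y, open W -> vfield W X -> vfield W Y ->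
    smooth_on W (fun p => g p (X p) (Y p)) ;
  metric_index : exists q, forall p, has_index g p q }.

Definition nabla_metric (g : bilinear_field) (nabla : connection)
    (X Y Z : vec_field M) (p : M) : R :=
  X p (fun q => g q (Y q) (Z q)) - g p (nabla X Y p) (Z p)
  - g p (Y p) (nabla X Z p).

Record statistical_manifold (g : bilinear_field) (nabla nablas : connection) :
    Prop := StatisticalManifold {
  stat_metric : semi_riemannian g ;
  stat_connection : affine_connection nabla ;
  stat_torsion_free : torsion_free nabla ;
  stat_codazzi : forall W X Y Z, open W ->
    vfield W X -> vfield W Y -> vfield W Z -> forall p, W p ->
    nabla_metric g nabla X Y Z p = nabla_metric g nabla Y X Z p ;
  stat_dual_connection : affine_connection nablas ;
  stat_dual : forall W X Y Z, open W ->
    vfield W X -> vfield W Y -> vfield W Z -> forall p, W p ->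
    X p (fun q => g q (Y q) (Z q)) =
      g p (nabla X Y p) (Z p) + g p (Y p) (nablas X Z p) }.

End VectorFields.

(** * Lightlike hypersurfaces *)

Section Hypersurfaces.
Variables (R : realType) (n : nat).
Variables (Mb : manifold R n.+2) (M : manifold R n.+1).
Variables (g : bilinear_field Mb) (i : M -> Mb).

Definition differential (p : M) (v : dvec M) : dvec Mb := fun f =>
  if `[< smooth_at (i p) f >] then v (fun q => f (i q)) else 0.

Definition immersion : Prop :=
  smooth_map i /\
  forall p u v, tangent p u -> tangent p v ->
    differential p u = differential p v -> u = v.

Definition normal_space (p : M) : set (dvec Mb) :=
  [set u | tangent (i p) u /\
           forall w, tangent p w -> g (i p) u (differential p w) = 0].

Definition Rad (p : M) : set (dvec M) :=
  [set v | tangent p v /\ normal_space p (differential p v)].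

Definition lightlike_hypersurface : Prop :=
  immersion /\ forall p, exists2 v, Rad p v & v != 0.

Record screen_distribution (S : M -> set (dvec M)) : Prop :=
  ScreenDistribution {
    screen_dist : distribution n S ;
    screen_nondegenerate : forall p u, S p u ->
      (forall v, S p v ->
         g (i p) (differential p u) (differential p v) = 0) -> u = 0 ;
    screen_sum : forall p v, tangent p v ->
      exists u w, [/\ S p u, Rad p w & v = u + w] ;
    screen_direct : forall p v, S p v -> Rad p v -> v = 0 }.

(* The projection TM -> S along Rad, as a morphism of vector bundles; its
   pointwise linearity follows from uniqueness of the decomposition. *)
Record screen_projection (S : M -> set (dvec M)) (P : M -> dvec M -> dvec M) :
    Prop := ScreenProjection {
  proj_screen : forall p v, tangent p v -> S p (P p v) ;
  proj_radical : forall p v, tangent p v -> Rad p (v - P p v) ;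
  proj_smooth : forall W X, open W -> vfield W X ->
    vfield W (fun p => P p (X p)) }.

Record radical_section (U : set M) (xi : vec_field M) : Prop :=
  RadicalSection {
    xi_open : open U ;
    xi_section : dsection Rad U xi ;
    xi_neq0 : forall p, U p -> xi p != 0 }.

Record null_transversal (S : M -> set (dvec M)) (U : set M) (xi : vec_field M)
    (N : M -> dvec Mb) : Prop := NullTransversal {
  transversal_field : vfield_along i U N ;
  transversal_null : forall p, U p -> g (i p) (N p) (N p) = 0 ;
  transversal_xi : forall p, U p ->
    g (i p) (N p) (differential p (xi p)) = 1 ;
  transversal_screen : forall p w, U p -> S p w ->
    g (i p) (N p) (differential p w) = 0 }.

(* The covariant derivative of vector fields along M induced by the ambient
   connection nablab, i.e. the pull-back connection on i^*(TMb), which these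
   conditions determine uniquely. Fields along M need not be restrictions of
   ambient fields, but are locally combinations of such restrictions. *)
Record pullback_connection (nablab : connection Mb)
    (D : vec_field M -> (M -> dvec Mb) -> (M -> dvec Mb)) : Prop :=
  PullbackConnection {
    pullback_conn : is_connection (vfield_along i) D ;
    pullback_chain : forall W A X X' Y', open W -> open A ->
      vfield W X -> vfield A X' -> vfield A Y' ->
      forall p, W p -> A (i p) -> X' (i p) = differential p (X p) ->
        D X (fun q => Y' (i q)) p = nablab X' Y' (i p) }.

Definition gauss_formula (D : vec_field M -> (M -> dvec Mb) -> (M -> dvec Mb))
    (nabla : connection M) (B : vec_field M -> vec_field M -> M -> R)
    (U : set M) (N : M -> dvec Mb) : Prop :=
  forall W X Y, open W -> W `<=` U -> vfield W X -> vfield W Y ->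
  forall p, W p ->
    D X (fun q => differential q (Y q)) p =
      differential p (nabla X Y p) + B X Y p *: N p.

(* Another choice of xi rescales N and B, leaving nabla unchanged: any family
   of local choices defines the same nabla. *)
Definition induced_connection (S : M -> set (dvec M)) (nablab : connection Mb)
    (nabla : connection M) : Prop :=
  (forall W X Y, open W -> vfield W X -> vfield W Y ->
     vfield W (nabla X Y)) /\
  exists D, pullback_connection nablab D /\
    forall p, exists U xi N B,
      [/\ U p, radical_section U xi, null_transversal S U xi N &
          gauss_formula D nabla B U N].

Record weingarten (S : M -> set (dvec M)) (nabla : connection M) (U : set M)
    (xi : vec_field M) (A : M -> dvec M -> dvec M) (tau : M -> dvec M -> R) :
    Prop := Weingarten {
  weingarten_form : one_form U tau ;
  weingarten_screen : forall p v, U p -> tangent p v -> S p (A p v) ;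
  weingarten_formula : forall W X, open W -> W `<=` U -> vfield W X ->
    forall p, W p ->
      nabla X xi p = - A p (X p) - tau p (X p) *: xi p }.

End Hypersurfaces.

(* Main.v *)
(** By transversality of N, the tangential part in the Gauss formula is
    well defined, so each induced connection inherits locality, linearity and
    the Leibniz rule from the pull-back connection; hence the two induced
    connections and their mean are affine connections. A distribution that is
    parallel for an affine connection is invariant under its curvature, and
    applying this to both terms of Z = PZ + (Z - PZ) shows that the curvature
    commutes with P. Since Rad(TM) is parallel, A_xi X is at once a screen and
    a radical vector, hence zero, so D_X xi = - tau(X) xi; two such derivatives
    contribute tau(X) tau(Y) symmetrically, and only - 2 d tau (X, Y) xi
    survives in the curvature. The mean connection satisfies the same equation
    with the form (tau + tau') / 2, tau' being the form of the dual connection. *)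

Require Import Defs.
From mathcomp Require Import all_boot all_order all_algebra.
From mathcomp Require Import all_classical all_reals all_analysis.
From mathcomp Require Import ring.
Set Implicit Arguments.
Unset Strict Implicit.
Unset Printing Implicit Defensive.
Import Order.TTheory GRing.Theory Num.Theory.
Import numFieldNormedType.Exports.
Local Open Scope classical_set_scope.
Local Open Scope ring_scope.

Local Notation coord := Defs.coord.

(** * Functions of class C^k *)

(** The difference [g - f] vanishes near [x], so the zero map satisfies the first-order expansion
    that characterises its differential there; [g] is then the sum of this difference and [f]. *)
Lemma near_eq_differentiable (R : realType) (V W : normedModType R)
    (f g : V -> W) (x : V) :
  (\forall y \near x, f y = g y) -> differentiable f x -> differentiable g x.
Proof.
move=> fg df.
suff de : differentiable (g - f) x.
  by rewrite -(subrK f g); exact: differentiableD.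
have e0 : (g - f) \o shift x = cst ((g - f) x) + \0 +o_ 0 id.
  apply/eqaddoP => _ /posnumP[e].
  rewrite [\forall y \near _, _ <= _](near_shift x) sub0r; near=> y.
  rewrite /= !fctE /= subrK -(nbhs_singleton fg).
  have <- : f y = g y by near: y; exact: fg.
  by rewrite !subrr addr0 subrr normr0 mulr_ge0.
have c0 : continuous (\0 : {linear V -> W}) by move=> ?; exact: cst_continuous.
by apply/diff_locallyP; rewrite (diff_unique c0 e0).
Unshelve. all: by end_near. Qed.

Section SmoothCoordinates.
Variables (R : realType) (n : nat).
Implicit Types (A : set 'rV[R]_n) (f g : 'rV[R]_n -> R).

(** Directional derivatives are total functions, so every clause of [Ck] is a test at individual
    points of [A]. This makes restriction and locality of smoothness immediate. *)
Lemma Ck_pointwise k A f : Ck k A f <-> forall x, A x -> Ck k [set x] f.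
Proof.
elim: k f => [|k IH] f /=.
  by split => [h x /h ? _ -> //|h x Ax]; exact: (h x Ax).
split=> [[df Df] x Ax|h].
  split=> [_ ->|v]; first exact: df.
  by have /IH := Df v; exact.
split=> [x Ax|v]; first by have [+ _] := h x Ax; apply.
by apply/IH => x /h[_]; apply.
Qed.

Lemma Ck_subset k A B f : A `<=` B -> Ck k B f -> Ck k A f.
Proof. by move=> AB /Ck_pointwise h; apply/Ck_pointwise => x /AB /h. Qed.

Lemma Ck_near_eq k A f g : (forall x, A x -> \forall y \near x, f y = g y) ->
  Ck k A f -> Ck k A g.
Proof.
elim: k f g => [|k IH] f g fg /=.
  move=> cf x Ax; have fgx := fg x Ax.
  rewrite /prop_for /continuous_at -(nbhs_singleton fgx).
  by apply: cvg_trans (near_eq_cvg fgx) (cf x Ax).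
move=> [df Df]; split=> [x Ax|v].
  exact: near_eq_differentiable (fg x Ax) (df x Ax).
(* Agreement near [x] is agreement near every [y] close to [x], so the derivatives also agree near
   [x], as the induction requires. *)
apply: IH (Df v) => x /fg /near_join; apply: filterS => y fgy.
exact: near_eq_derive.
Qed.

Lemma Ck_eq k A f g : open A -> (forall x, A x -> f x = g x) ->
  Ck k A f -> Ck k A g.
Proof.
move=> oA fg; apply: Ck_near_eq => x Ax.
by apply: filterS (open_nbhs_nbhs (conj oA Ax)).
Qed.

Lemma Ck_succ k A f : Ck k.+1 A f -> Ck k A f.
Proof.
elim: k f => [|k IH] f [df Df].
  by move=> x /df /differentiable_continuous.
by split=> // v; apply: IH.
Qed.

Lemma Ck_cst k A (c : R) : Ck k A (fun=> c).
Proof.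
elim: k c => [|k IH] c; first by move=> x _; exact: cst_continuous.
split=> [x _|v]; first exact: differentiable_cst.
by under eq_fun do rewrite derive_cst; exact: IH.
Qed.

Lemma CkD k A f g : open A -> Ck k A f -> Ck k A g ->
  Ck k A (fun x => f x + g x).
Proof.
move=> oA; elim: k f g => [|k IH] f g.
  by move=> cf cg x Ax; apply: (continuousD (cf x Ax) (cg x Ax)).
move=> [df Df] [dg Dg]; split=> [x Ax|v].
  by apply: (differentiableD (df x Ax) (dg x Ax)).
apply: Ck_eq oA _ (IH _ _ (Df v) (Dg v)) => x Ax.
by rewrite -deriveD //; apply: diff_derivable; [exact: df|exact: dg].
Qed.

Lemma CkM k A f g : open A -> Ck k A f -> Ck k A g ->
  Ck k A (fun x => f x * g x).
Proof.
move=> oA; elim: k f g => [|k IH] f g.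
  by move=> cf cg x Ax; apply: (continuousM (cf x Ax) (cg x Ax)).
move=> Cf Cg; have [[df Df] [dg Dg]] := (Cf, Cg); split=> [x Ax|v].
  by apply: (differentiableM (df x Ax) (dg x Ax)).
(* Product rule: each summand pairs a derivative, of class C^k, with an undifferentiated factor,
   whose class is lowered from C^(k+1) to C^k. *)
apply: Ck_eq oA _ (CkD oA (IH _ _ (Ck_succ Cf) (Dg v))
                          (IH _ _ (Ck_succ Cg) (Df v))) => x Ax.
by rewrite -[RHS]/('D_v (f * g) x) deriveM //;
  apply: diff_derivable; [exact: df|exact: dg].
Qed.

Lemma Ck_sum k A (I : Type) (r : seq I) (f : I -> 'rV[R]_n -> R) : open A ->
  (forall j, Ck k A (f j)) -> Ck k A (fun x => \sum_(j <- r) f j x).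
Proof.
move=> oA Cf; elim: r => [|j r IH].
  by under eq_fun do rewrite big_nil; exact: Ck_cst.
by under eq_fun do rewrite big_cons; exact: CkD.
Qed.

End SmoothCoordinates.

(** * The chain rule in coordinates and stability of C^k under composition *)

Section ChainRule.
Variables (R : realType) (m n : nat).
Implicit Types (G : 'rV[R]_m -> 'rV[R]_n) (f : 'rV[R]_n -> R).

Lemma row_fun_sum G :
  G = \sum_(j < n) (fun x => G x ord0 j *: (delta_mx 0 j : 'rV[R]_n)).
Proof. by apply/funext => x; rewrite fct_sumE -row_sum_delta. Qed.

Lemma row_continuous G x :
  (forall j, {for x, continuous (fun y => G y ord0 j)}) ->
  {for x, continuous G}.
Proof.
move=> cG; rewrite (row_fun_sum G).
elim/big_ind : _ => [|f1 f2 c1 c2|j _].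
- exact: cst_continuous.
- exact: continuousD.
- by apply: continuousZr_tmp; exact: cG.
Qed.

Lemma row_differentiable G x :
  (forall j, differentiable (fun y => G y ord0 j) x) -> differentiable G x.
Proof.
move=> dG; rewrite (row_fun_sum G); apply: differentiable_sum => j.
exact: differentiableZl.
Qed.

(** The differential of [f] at [G x] is expanded along the standard basis, which turns the abstract
    chain rule into a sum of products of scalar functions, a form suited to induction on the
    order. *)
Lemma derive_comp_row f G x v :
  (forall j, differentiable (fun y => G y ord0 j) x) ->
  differentiable f (G x) ->
  'D_v (fun y => f (G y)) x =
    \sum_(j < n) 'D_(delta_mx 0 j) f (G x) * 'D_v (fun y => G y ord0 j) x.
Proof.
move=> dGj df; have dG := row_differentiable dGj.
rewrite deriveE; last exact: (differentiable_comp dG df).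
rewrite (diff_comp dG df) /= [X in 'd f _ X]row_sum_delta linear_sum /=.
apply: eq_bigr => j _; rewrite linearZ /= deriveE // mulrC; congr (_ * _).
by rewrite -deriveE // derive_mx ?mxE //; exact: diff_derivable.
Qed.

Lemma Ck_comp k (A : set 'rV[R]_m) (B : set 'rV[R]_n) f G : open A ->
  (forall x, A x -> B (G x)) -> Ck k B f ->
  (forall j, Ck k A (fun x => G x ord0 j)) -> Ck k A (fun x => f (G x)).
Proof.
move=> oA AB; elim: k f => [|k IH] f.
  move=> cf cG x Ax; apply: continuous_comp; last exact/cf/AB.
  by apply: row_continuous => j; exact: cG.
move=> [df Df] CG; split=> [x Ax|v].
  apply: differentiable_comp; last exact/df/AB.
  by apply: row_differentiable => j; have [+ _] := CG j; exact.
(* The summands of the chain rule: the first factor is again a composition with [G], covered by the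
   induction hypothesis for a partial derivative of [f]. *)
pose F j x := 'D_(delta_mx 0 j) f (G x) * 'D_v (fun y => G y ord0 j) x.
suff CF : Ck k A (fun x => \sum_(j < n) F j x).
  apply: Ck_eq oA _ CF => x Ax; rewrite derive_comp_row //; last exact/df/AB.
  by move=> j; have [+ _] := CG j; exact.
apply: (Ck_sum _ oA) => j; apply: (CkM oA); last 
  by have [_] := CG j; exact.
by apply: (IH _ (Df _)) => l; exact: Ck_succ.
Qed.

End ChainRule.

(** * Smooth functions and vector fields on manifolds *)

Section SmoothFunctions.
Variables (R : realType) (n : nat) (M : manifold R n).
Implicit Types (W A : set M) (f g : M -> R) (p : M) (a : chart M).

(** The axioms of [manifold] are anonymous fields; this lemma and the next four give names to five
    of them. *)
Lemma chart_cover p : exists a, dom a p.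
Proof. by case: M p. Qed.

Lemma dom_open a : open (dom a).
Proof. by case: M a. Qed.

Lemma paramK a p : dom a p -> param a (coord a p) = p.
Proof. by case: M a p. Qed.

Lemma coord_dom_open a : open (coord a @` dom a).
Proof. by case: M a. Qed.

Lemma param_continuous a x :
  (coord a @` dom a) x -> {for x, continuous (param a)}.
Proof. by case: M a x. Qed.

Lemma coord_image_open a W : open W -> open (coord a @` (W `&` dom a)).
Proof.
move=> oW.
have oa : open (coord a @` dom a) by exact: coord_dom_open.
rewrite openE => _ [p [Wp ap] <-].
have ax : (coord a @` dom a) (coord a p) by exists p.
have Wx : nbhs (param a (coord a p)) W.
  by apply: open_nbhs_nbhs; split => //; rewrite paramK.
near=> y.
have [q aq qy] : (coord a @` dom a) y.
  by near: y; exact: open_nbhs_nbhs.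
exists q => //; split => //; rewrite -(paramK aq) qy.
by near: y; exact: (param_continuous ax) Wx.
Unshelve. all: by end_near. Qed.

Lemma smooth_on_subset W A f : W `<=` A -> smooth_on A f -> smooth_on W f.
Proof.
move=> WA Cf a k; apply: Ck_subset (Cf a k).
by apply: image_subset => p [/WA].
Qed.

Lemma smooth_on_eq W f g : open W -> (forall p, W p -> f p = g p) ->
  smooth_on W f -> smooth_on W g.
Proof.
move=> oW fg Cf a k; apply: Ck_eq (Cf a k); first exact: coord_image_open.
by move=> _ [p [Wp ap] <-]; rewrite paramK // fg.
Qed.

Lemma smooth_on_pointwise W f :
  (forall p, W p -> smooth_at p f) -> smooth_on W f.
Proof.
move=> Cf a k; apply/Ck_pointwise => _ [p [Wp ap] <-].
have [A [oA Ap /(_ a k) CA]] := Cf p Wp.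
by apply: Ck_subset CA => _ ->; exists p.
Qed.

Lemma smooth_onD W f g : open W -> smooth_on W f -> smooth_on W g ->
  smooth_on W (fun p => f p + g p).
Proof.
move=> oW Cf Cg a k.
by apply: (CkD (coord_image_open oW)); [exact: Cf|exact: Cg].
Qed.

Lemma smooth_onM W f g : open W -> smooth_on W f -> smooth_on W g ->
  smooth_on W (fun p => f p * g p).
Proof.
move=> oW Cf Cg a k.
by apply: (CkM (coord_image_open oW)); [exact: Cf|exact: Cg].
Qed.

Lemma smooth_on_cst W (c : R) : smooth_on W (fun=> c).
Proof. by move=> a k; exact: Ck_cst. Qed.

Lemma smooth_on_scale W (c : R) f : open W -> smooth_on W f ->
  smooth_on W (fun p => c * f p).
Proof.
by move=> oW; apply: (smooth_onM oW (f := fun=> c)); exact: smooth_on_cst.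
Qed.

Lemma smooth_onB W f g : open W -> smooth_on W f -> smooth_on W g ->
  smooth_on W (fun p => f p - g p).
Proof.
move=> oW Cf /(smooth_on_scale (-1) oW) Cg.
by under eq_fun do rewrite -mulN1r; exact: smooth_onD oW Cf Cg.
Qed.

Lemma smooth_on_at W f p : open W -> W p -> smooth_on W f -> smooth_at p f.
Proof. by exists W. Qed.

Lemma smooth_at_near p f : smooth_at p f -> \forall q \near p, smooth_at q f.
Proof.
move=> [W [oW Wp Cf]]; apply: filterS (open_nbhs_nbhs (conj oW Wp)) => q Wq.
exact: smooth_on_at Cf.
Qed.

Lemma smooth_at2 p f g : smooth_at p f -> smooth_at p g ->
  exists W, [/\ open W, W p, smooth_on W f & smooth_on W g].
Proof.
move=> [W [oW Wp Cf]] [A [oA Ap Cg]]; exists (W `&` A); split => //.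
- exact: openI.
- by apply: smooth_on_subset Cf => q [].
- by apply: smooth_on_subset Cg => q [].
Qed.

Lemma smooth_at_cst p (c : R) : smooth_at p (fun=> c).
Proof. by exists setT; split=> //; [exact: openT|exact: smooth_on_cst]. Qed.

Lemma smooth_atD p f g : smooth_at p f -> smooth_at p g ->
  smooth_at p (fun q => f q + g q).
Proof.
move=> Cf /(smooth_at2 Cf)[W [oW Wp Cf' Cg]].
by apply: (smooth_on_at oW Wp); exact: smooth_onD.
Qed.

Lemma smooth_atM p f g : smooth_at p f -> smooth_at p g ->
  smooth_at p (fun q => f q * g q).
Proof.
move=> Cf /(smooth_at2 Cf)[W [oW Wp Cf' Cg]].
by apply: (smooth_on_at oW Wp); exact: smooth_onM.
Qed.

Lemma smooth_at_lin p (c : R) f g : smooth_at p f -> smooth_at p g ->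
  smooth_at p (fun q => c * f q + g q).
Proof.
by move=> Cf Cg; apply: (smooth_atD (smooth_atM (smooth_at_cst _ c) Cf)).
Qed.

Lemma smooth_at_near_eq p f g : (\forall q \near p, f q = g q) ->
  smooth_at p f -> smooth_at p g.
Proof.
move=> fg; have : nbhs p [set q | f q = g q] by exact: fg.
rewrite nbhsE => -[B [oB Bp] fgB] [W [oW Wp Cf]].
have oWB : open (W `&` B) by exact: openI.
apply: (smooth_on_at oWB) => //; apply: (smooth_on_eq oWB (f := f)).
  by move=> q [_ /fgB].
by apply: smooth_on_subset Cf => q [].
Qed.

End SmoothFunctions.

Lemma smooth_on_comp (R : realType) (m n : nat) (M : manifold R m)
    (M' : manifold R n) (F : M -> M') (A : set M') (f : M' -> R) :
  smooth_map F -> open A -> smooth_on A f ->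
  smooth_on (F @^-1` A) (fun p => f (F p)).
Proof.
move=> [cF CF] oA Cf; apply: smooth_on_pointwise => p Ap.
have [b bp] := chart_cover (F p).
(* On this neighbourhood of [p] the map [F] lands in the single chart [b], so [f] after [F] reads in
   coordinates as a composition of two smooth maps between row spaces. *)
have oW : open (F @^-1` (A `&` dom b)).
  by apply: open_comp => [q _|]; [exact: cF|apply: openI oA _; exact: dom_open].
apply: (smooth_on_at oW) => // a k.
have oaW := coord_image_open (a := a) oW.
apply: (Ck_eq (f := fun x => f (param b (coord b (F (param a x))))) oaW).
  by move=> _ [q [[_ bq] aq] <-]; rewrite paramK ?paramK.
apply: (Ck_comp (f := fun y => f (param b y)) oaW _ (Cf b k)).
  by move=> _ [q [[Aq bq] aq] <-]; rewrite paramK //; exists (F q).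
move=> j; apply: Ck_subset (CF b j a k).
by apply: image_subset => q [[]].
Qed.

(** * Tangent vectors, vector fields and their bracket *)

Section TangentVectors.
Variables (R : realType) (n : nat) (M : manifold R n).
Implicit Types (p : M) (u v : dvec M) (W A : set M) (X Y : vec_field M).

Lemma dvec_linE (a : R) u v f : (a *: u + v) f = a * u f + v f.
Proof. by []. Qed.

Lemma tangent_lin p (a : R) u v :
  tangent p u -> tangent p v -> tangent p (a *: u + v).
Proof.
move=> tu tv; split=> [c f g Cf Cg|f g Cf Cg|f g Cf fg|f Cf];
  rewrite !dvec_linE.
- by rewrite (tangent_linear tu c Cf Cg) (tangent_linear tv c Cf Cg); ring.
- by rewrite (tangent_leibniz tu Cf Cg) (tangent_leibniz tv Cf Cg); ring.
- by rewrite (tangent_germ tu Cf fg) (tangent_germ tv Cf fg).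
- by rewrite (tangent_junk tu Cf) (tangent_junk tv Cf); ring.
Qed.

Lemma tangent_cst p v (c : R) : tangent p v -> v (fun=> c) = 0.
Proof.
move=> tv.
have s1 := smooth_at_cst p 1; have s0 := smooth_at_cst p 0.
(* The Leibniz rule on 1 = 1 * 1 gives [v 1 = v 1 + v 1]; other constants follow by linearity. *)
have v1 : v (fun=> 1) = 0.
  have := tangent_leibniz tv s1 s1; rewrite !(mulr1, mul1r) => v1D.
  by apply: (addrI (v (fun=> 1))); rewrite addr0 -v1D.
have v0 : v (fun=> 0) = 0.
  by have := tangent_linear tv (- 1) s0 s0; rewrite mulr0 addr0 mulN1r addNr.
have := tangent_linear tv c s1 s0.
by rewrite mulr1 addr0 v1 v0 mulr0 addr0.
Qed.

Lemma tangentZ p v (c : R) f : tangent p v -> smooth_at p f ->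
  v (fun q => c * f q) = c * v f.
Proof.
move=> tv Cf; have := tangent_linear tv c Cf (smooth_at_cst p 0).
by under eq_fun do rewrite addr0; rewrite (tangent_cst 0 tv) addr0.
Qed.

Lemma vfield_at W X p : vfield W X -> W p -> tangent p (X p).
Proof. by case=> tX _ /tX. Qed.

Lemma vfield_deriv W A X f : open A -> vfield W X -> smooth_on A f ->
  smooth_on (W `&` A) (fun p => X p f).
Proof. by move=> oA [_]; exact. Qed.

Lemma vfield_subset W A X : W `<=` A -> vfield A X -> vfield W X.
Proof.
move=> WA [tX CX]; split=> [p /WA|B f oB Cf]; first exact: tX.
by apply: smooth_on_subset (CX B f oB Cf) => p [/WA].
Qed.

Lemma vfield_lin W f X Y : open W -> smooth_on W f ->
  vfield W X -> vfield W Y -> vfield W (fun p => f p *: X p + Y p).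
Proof.
move=> oW Cf vX vY; split=> [p Wp|A h oA Ch].
  by apply: tangent_lin; [exact: vfield_at vX Wp|exact: vfield_at vY Wp].
have oWA : open (W `&` A) by exact: openI.
apply: (smooth_onD (f := fun p => f p * X p h) oWA); last exact: vfield_deriv.
apply: (smooth_onM oWA); last exact: vfield_deriv.
by apply: smooth_on_subset Cf => p [].
Qed.

Lemma vfieldD W X Y : open W -> vfield W X -> vfield W Y ->
  vfield W (fun p => X p + Y p).
Proof.
move=> oW vX vY; under eq_fun do rewrite -[X _]scale1r.
exact: vfield_lin (smooth_on_cst _ 1) vX vY.
Qed.

Lemma vfield0 W X : open W -> vfield W X -> vfield W (fun=> 0).
Proof.
move=> oW vX; have := vfield_lin oW (smooth_on_cst _ (-1)) vX vX.
by under eq_fun do rewrite scaleN1r addNr.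
Qed.

Lemma vfieldZ W f X : open W -> smooth_on W f -> vfield W X ->
  vfield W (fun p => f p *: X p).
Proof.
move=> oW Cf vX; have := vfield_lin oW Cf vX (vfield0 oW vX).
by under eq_fun do rewrite addr0.
Qed.

Lemma vfieldB W X Y : open W -> vfield W X -> vfield W Y ->
  vfield W (fun p => X p - Y p).
Proof.
move=> oW vX vY; under eq_fun do rewrite addrC -scaleN1r.
exact: vfield_lin (smooth_on_cst _ (-1)) vY vX.
Qed.

Lemma smooth_at_deriv W X p f : open W -> vfield W X -> W p ->
  smooth_at p f -> smooth_at p (fun q => X q f).
Proof.
move=> oW vX Wp [A [oA Ap Cf]].
by apply: (smooth_on_at (openI oW oA)) => //; exact: vfield_deriv.
Qed.

(** Differentiating a second time at [p] requires the rules for [X] on a whole neighbourhood of [p];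
    this lemma and the next two provide linearity, the Leibniz rule and dependence on germs in that
    form. *)
Lemma near_deriv_lin W X p (c : R) f g : open W -> vfield W X -> W p ->
    smooth_at p f -> smooth_at p g ->
  \forall q \near p, c * X q f + X q g = X q (fun x => c * f x + g x).
Proof.
move=> oW vX Wp /smooth_at_near Cf /smooth_at_near Cg.
have nW := open_nbhs_nbhs (conj oW Wp); apply: filterS3 nW Cf Cg => q Wq Cf Cg.
by rewrite (tangent_linear (vfield_at vX Wq)).
Qed.

Lemma near_deriv_mul W X p f g : open W -> vfield W X -> W p ->
    smooth_at p f -> smooth_at p g ->
  \forall q \near p, X q f * g q + f q * X q g = X q (fun x => f x * g x).
Proof.
move=> oW vX Wp /smooth_at_near Cf /smooth_at_near Cg.
have nW := open_nbhs_nbhs (conj oW Wp); apply: filterS3 nW Cf Cg => q Wq Cf Cg.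
by rewrite (tangent_leibniz (vfield_at vX Wq)).
Qed.

Lemma near_deriv_germ W X p f g : open W -> vfield W X -> W p ->
    smooth_at p f -> (\forall q \near p, f q = g q) ->
  \forall q \near p, X q f = X q g.
Proof.
move=> oW vX Wp /smooth_at_near Cf /near_join fg.
have nW := open_nbhs_nbhs (conj oW Wp); apply: filterS3 nW Cf fg => q Wq Cf fg.
exact: (tangent_germ (vfield_at vX Wq) Cf fg).
Qed.

Lemma bracketE X Y p f : smooth_at p f ->
  bracket X Y p f = X p (fun q => Y q f) - Y p (fun q => X q f).
Proof. by move=> Cf; rewrite /bracket asboolT. Qed.

Lemma deriv_deriv_lin W X Y p (c : R) f g : open W ->
    vfield W X -> vfield W Y -> W p -> smooth_at p f -> smooth_at p g ->
  X p (fun q => Y q (fun x => c * f x + g x)) =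
  c * X p (fun q => Y q f) + X p (fun q => Y q g).
Proof.
move=> oW vX vY Wp Cf Cg; have tX := vfield_at vX Wp.
have CYf := smooth_at_deriv oW vY Wp Cf.
have CYg := smooth_at_deriv oW vY Wp Cg.
rewrite -(tangent_linear tX _ CYf CYg); apply/esym.
apply: (tangent_germ tX); first exact: smooth_at_lin.
exact: (near_deriv_lin c oW vY Wp Cf Cg).
Qed.

(** The Leibniz rule is used twice. The two mixed terms are exchanged when [X] and [Y] are, so they
    cancel in the bracket, which is therefore a derivation. *)
Lemma deriv_deriv_mul W X Y p f g : open W ->
    vfield W X -> vfield W Y -> W p -> smooth_at p f -> smooth_at p g ->
  X p (fun q => Y q (fun x => f x * g x)) =
  X p (fun q => Y q f) * g p + Y p f * X p g
  + (X p f * Y p g + f p * X p (fun q => Y q g)).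
Proof.
move=> oW vX vY Wp Cf Cg; have tX := vfield_at vX Wp.
have CYf := smooth_at_deriv oW vY Wp Cf.
have CYg := smooth_at_deriv oW vY Wp Cg.
rewrite -(tangent_germ tX _ (near_deriv_mul oW vY Wp Cf Cg)); last first.
  by apply: smooth_atD; exact: smooth_atM.
have := tangent_linear tX 1 (smooth_atM CYf Cg) (smooth_atM Cf CYg).
under eq_fun do rewrite mul1r; rewrite mul1r => ->.
by rewrite (tangent_leibniz tX CYf Cg) (tangent_leibniz tX Cf CYg).
Qed.

Lemma vfield_bracket W X Y : open W -> vfield W X -> vfield W Y ->
  vfield W (bracket X Y).
Proof.
move=> oW vX vY; split=> [p Wp|A f oA Cf].
  split=> [c f g Cf Cg|f g Cf Cg|f g Cf fg|f Cf].
  - rewrite !bracketE //; last exact: smooth_at_lin.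
    rewrite (deriv_deriv_lin c oW vX vY Wp Cf Cg).
    by rewrite (deriv_deriv_lin c oW vY vX Wp Cf Cg); ring.
  - rewrite !bracketE //; last exact: smooth_atM.
    rewrite (deriv_deriv_mul oW vX vY Wp Cf Cg).
    by rewrite (deriv_deriv_mul oW vY vX Wp Cf Cg); ring.
  - have Cg := smooth_at_near_eq fg Cf; rewrite !bracketE //.
    congr (_ - _); apply: tangent_germ.
    + exact: vfield_at vX Wp.
    + exact: (smooth_at_deriv oW vY Wp Cf).
    + exact: (near_deriv_germ oW vY Wp Cf fg).
    + exact: vfield_at vY Wp.
    + exact: (smooth_at_deriv oW vX Wp Cf).
    + exact: (near_deriv_germ oW vX Wp Cf fg).
  (* The default value 0 of [bracket] at functions not smooth at [p] is what [tangent_junk]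
     demands. *)
  - by rewrite /bracket asboolF.
have oWA : open (W `&` A) by exact: openI.
have smooth_dd X1 X2 : vfield W X1 -> vfield W X2 ->
    smooth_on (W `&` A) (fun p => X1 p (fun q => X2 q f)).
  move=> v1 v2; have := vfield_deriv oWA v1 (vfield_deriv oA v2 Cf).
  by rewrite setIA setIid.
apply: (smooth_on_eq oWA _ (smooth_onB oWA (smooth_dd _ _ vX vY)
                                           (smooth_dd _ _ vY vX))).
by move=> p [Wp Ap]; rewrite bracketE //; exact: smooth_on_at Cf.
Qed.

End TangentVectors.

(** * The differential of a smooth map on tangent vectors and vector fields *)

Section Differential.
Variables (R : realType) (n : nat) (M : manifold R n.+1) (M' : manifold R n.+2).
Variable i : M -> M'.
Hypothesis smooth_i : smooth_map i.

Lemma differentialE p (v : dvec M) f : smooth_at (i p) f ->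
  differential i p v f = v (fun q => f (i q)).
Proof. by move=> Cf; rewrite /differential asboolT. Qed.

Lemma smooth_at_comp p f : smooth_at (i p) f ->
  smooth_at p (fun q => f (i q)).
Proof.
move=> [A [oA Ap Cf]]; exists (i @^-1` A); split=> //.
  by apply: open_comp => // q _; case: smooth_i => + _; exact.
exact: smooth_on_comp.
Qed.

(** Stated for arbitrary functionals so that it rewrites under binders: at a test function not
    smooth at [i p], both sides take the default value 0. *)
Lemma differentialD p (u v : dvec M) :
  differential i p (u + v) = differential i p u + differential i p v.
Proof.
apply/funext => f; rewrite [RHS]/GRing.add /= /differential.
by case: ifP => //= _; rewrite addr0.
Qed.

Lemma differentialZ p (a : R) (u : dvec M) :
  differential i p (a *: u) = a *: differential i p u.
Proof.
apply/funext => f; rewrite [RHS]/GRing.scale /= /differential.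
by case: ifP => //= _; rewrite scaler0.
Qed.

Lemma differential_lin p (a : R) (u v : dvec M) :
  differential i p (a *: u + v) =
  a *: differential i p u + differential i p v.
Proof. by rewrite differentialD differentialZ. Qed.

Lemma differential_tangent p (v : dvec M) : tangent p v ->
  tangent (i p) (differential i p v).
Proof.
move=> tv; split=> [a f g Cf Cg|f g Cf Cg|f g Cf fg|f Cf].
- rewrite !differentialE //; last exact: smooth_at_lin.
  exact: (tangent_linear tv _ (smooth_at_comp Cf) (smooth_at_comp Cg)).
- rewrite !differentialE //; last exact: smooth_atM.
  exact: (tangent_leibniz tv (smooth_at_comp Cf) (smooth_at_comp Cg)).
- rewrite !differentialE //; last exact: smooth_at_near_eq Cf.
  apply: (tangent_germ tv (smooth_at_comp Cf)).
  by case: smooth_i => /(_ p) ci _; exact: ci fg.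
- by rewrite /differential asboolF.
Qed.

Lemma differential_vfield W (X : vec_field M) : open W -> vfield W X ->
  vfield_along i W (fun p => differential i p (X p)).
Proof.
move=> oW vX; split=> [p Wp|A f oA Cf].
  by apply: differential_tangent; exact: vfield_at Wp.
have oiA : open (i @^-1` A).
  by apply: open_comp => // q _; case: smooth_i => + _; exact.
apply: (smooth_on_eq (openI oW oiA) _
  (vfield_deriv oiA vX (smooth_on_comp smooth_i oA Cf))).
by move=> p [_ Ap]; rewrite differentialE //; exact: smooth_on_at Cf.
Qed.

End Differential.

(** * Affine connections and their curvature *)

Section AffineConnections.
Variables (R : realType) (n : nat) (M : manifold R n).
Implicit Types (W : set M) (X Y Z : vec_field M) (D : connection M).
Implicit Types (E : M -> set (dvec M)).

(** The common property of the screen, described by local frames, and of the radical, described by a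
    pointwise orthogonality condition, on which the curvature arguments rest. *)
Definition fiber_linear E := forall p (a : R) u v,
  E p u -> E p v -> E p (a *: u + v).

Lemma fiber_linearB E p u v : fiber_linear E -> E p u -> E p v -> E p (u - v).
Proof. by move=> lE Eu Ev; rewrite addrC -scaleN1r; exact: lE. Qed.

Lemma fiber_linearZ E p (a : R) u : fiber_linear E -> E p u -> E p (a *: u).
Proof.
(* The multiple is written as [(a - 1) *: u + u], which avoids asking for the zero vector in
   [E p]. *)
move=> lE Eu; rewrite -[a](subrK 1) scalerDl scale1r; exact: lE.
Qed.

Lemma fiber_linearD E p u v : fiber_linear E -> E p u -> E p v -> E p (u + v).
Proof. by move=> lE Eu Ev; rewrite -[u]scale1r; exact: lE. Qed.

(** Parallelism, applied twice for the iterated derivatives and once along the bracket, keeps each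
    of the three terms of the curvature in [E]. *)
Lemma dsection_curvature D E W X Y Z : fiber_linear E -> parallel D E ->
    open W -> vfield W X -> vfield W Y -> dsection E W Z ->
  dsection E W (curvature D X Y Z).
Proof.
move=> lE pE oW vX vY sZ.
have [v1 E1] := pE _ _ _ oW vX (pE _ _ _ oW vY sZ).
have [v2 E2] := pE _ _ _ oW vY (pE _ _ _ oW vX sZ).
have [v3 E3] := pE _ _ _ oW (vfield_bracket oW vX vY) sZ.
split; first by apply: (vfieldB oW _ v3); exact: vfieldB.
move=> p Wp; apply: (fiber_linearB lE _ (E3 p Wp)).
exact: (fiber_linearB lE (E1 p Wp) (E2 p Wp)).
Qed.

Lemma curvatureD D W X Y Z Z' p : affine_connection D -> open W ->
    vfield W X -> vfield W Y -> vfield W Z -> vfield W Z' -> W p ->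
  curvature D X Y (fun q => Z q + Z' q) p =
  curvature D X Y Z p + curvature D X Y Z' p.
Proof.
move=> aD oW vX vY vZ vZ' Wp.
have DD X1 X2 : vfield W X1 -> vfield W X2 ->
    D X1 (D X2 (fun q => Z q + Z' q)) p = D X1 (D X2 Z) p + D X1 (D X2 Z') p.
  move=> v1 v2; have sec V := conn_section aD oW v2 (V := V).
  rewrite -(conn_additive aD oW v1 (sec _ vZ) (sec _ vZ') Wp).
  (* The inner derivative is additive only at points of [W], so it is replaced under the outer one
     by locality rather than by rewriting. *)
  apply: (conn_local aD oW v1 v1) => //.
  - by apply: sec; exact: vfieldD.
  - by apply: vfieldD => //; exact: sec.
  - by move=> q Wq; rewrite (conn_additive aD oW v2 vZ vZ' Wq).
rewrite /curvature !DD // (conn_additive aD oW (vfield_bracket oW vX vY)) //.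
by rewrite !opprD [X in X + _ = _]addrACA [LHS]addrACA.
Qed.

Lemma mean_affine D D' : affine_connection D -> affine_connection D' ->
  affine_connection (mean_connection D D').
Proof.
move=> aD aD'; split.
- move=> W X V oW vX vV.
  apply: (vfieldZ (f := fun=> 2^-1) oW (@smooth_on_cst _ _ _ _ _)).
  apply: (vfieldD oW); first exact: (conn_section aD oW vX vV).
  exact: (conn_section aD' oW vX vV).
- move=> W X X' V V' oW vX vX' vV vV' XX' VV' p Wp; rewrite /mean_connection.
  by rewrite (conn_local aD oW vX vX' vV vV' XX' VV' Wp)
             (conn_local aD' oW vX vX' vV vV' XX' VV' Wp).
- move=> W f X X' V oW Cf vX vX' vV p Wp; rewrite /mean_connection.
  rewrite (conn_linear aD oW Cf vX vX' vV Wp)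
    (conn_linear aD' oW Cf vX vX' vV Wp).
  by rewrite addrACA -scalerDr [LHS]scalerDr !scalerA (mulrC (f p)).
- move=> W X V V' oW vX vV vV' p Wp; rewrite /mean_connection.
  rewrite (conn_additive aD oW vX vV vV' Wp)
    (conn_additive aD' oW vX vV vV' Wp).
  by rewrite addrACA scalerDr.
- move=> W f X V oW Cf vX vV p Wp; rewrite /mean_connection.
  rewrite (conn_leibniz aD oW Cf vX vV Wp) (conn_leibniz aD' oW Cf vX vV Wp).
  (* The derivative of [f] appears once for each connection; the weights 1/2 add up to 1, which is
     why the mean obeys the Leibniz rule. *)
  rewrite addrACA -scalerDl -scalerDr [LHS]scalerDr !scalerA (mulrC (f p)).
  by congr (_ *: _ + _); field.
Qed.

Lemma mean_parallel D D' E : fiber_linear E -> parallel D E -> parallel D' E ->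
  parallel (mean_connection D D') E.
Proof.
move=> lE pD pD' W X Y oW vX sY.
have [v1 E1] := pD _ _ _ oW vX sY; have [v2 E2] := pD' _ _ _ oW vX sY.
split=> [|p Wp].
  apply: (vfieldZ (f := fun=> 2^-1) oW (@smooth_on_cst _ _ _ _ _)).
  exact: vfieldD.
apply: (fiber_linearZ _ lE).
exact: (fiber_linearD lE (E1 p Wp) (E2 p Wp)).
Qed.

(** Differentiating [D V Z = - t V *: Z] again gives the coefficient [t X2 * t X1 - X1 (t X2)]. The
    product is symmetric, and the terms left after antisymmetrisation form the exterior derivative
    of [t]. It serves for [xi] with each of the three connections. *)
Lemma curvature_recurrent D W X Y Z (t : M -> dvec M -> R) :
    affine_connection D -> open W -> vfield W X -> vfield W Y -> vfield W Z ->
    smooth_on W (fun q => t q (X q)) -> smooth_on W (fun q => t q (Y q)) ->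
    (forall V, vfield W V -> forall q, W q -> D V Z q = - t q (V q) *: Z q) ->
  forall p, W p -> curvature D X Y Z p = - (2 * ext_d t X Y p) *: Z p.
Proof.
move=> aD oW vX vY vZ CtX CtY DZ p Wp.
have DD X1 X2 : vfield W X1 -> vfield W X2 ->
    smooth_on W (fun q => t q (X2 q)) ->
    D X1 (D X2 Z) p =
    (t p (X2 p) * t p (X1 p) - X1 p (fun q => t q (X2 q))) *: Z p.
  move=> v1 v2 Ct.
  have CtN : smooth_on W (fun q => - t q (X2 q)).
    by under eq_fun do rewrite -mulN1r; exact: (smooth_on_scale (-1) oW Ct).
  (* The equation for [Z] holds only on [W], so locality is what allows it to be substituted inside
     the outer derivative. *)
  rewrite (conn_local aD oW v1 v1 (conn_section aD oW v2 vZ)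
    (vfieldZ oW CtN vZ) _ (DZ _ v2) Wp) //.
  rewrite (conn_leibniz aD oW CtN v1 vZ Wp) DZ // scalerA -scalerDl.
  have := tangentZ (-1) (vfield_at v1 Wp) (smooth_on_at oW Wp Ct).
  under eq_fun do rewrite mulN1r.
  by move=> ->; congr (_ *: _); rewrite mulN1r mulrNN addrC.
rewrite /curvature !DD // (DZ _ (vfield_bracket oW vX vY)) //.
rewrite -!scalerBl; congr (_ *: _); rewrite /ext_d.
by field.
Qed.

Lemma ext_d_mean W X Y p (t t' : M -> dvec M -> R) :
    open W -> W p -> vfield W X -> vfield W Y ->
    smooth_on W (fun q => t q (X q)) -> smooth_on W (fun q => t q (Y q)) ->
    smooth_on W (fun q => t' q (X q)) -> smooth_on W (fun q => t' q (Y q)) ->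
  ext_d (fun q v => 2^-1 * (t q v + t' q v)) X Y p =
  2^-1 * (ext_d t X Y p + ext_d t' X Y p).
Proof.
move=> oW Wp vX vY CX CY CX' CY'.
have lin Z f f' : vfield W Z -> smooth_on W f -> smooth_on W f' ->
    Z p (fun q => 2^-1 * (f q + f' q)) = 2^-1 * (Z p f + Z p f').
  move=> vZ Cf Cf'; have tZ := vfield_at vZ Wp.
  have [sf sf'] := (smooth_on_at oW Wp Cf, smooth_on_at oW Wp Cf').
  rewrite (tangentZ _ tZ (smooth_atD sf sf')).
  have := tangent_linear tZ 1 sf sf'.
  by under eq_fun do rewrite mul1r; rewrite mul1r => ->.
by rewrite /ext_d !lin //; ring.
Qed.

End AffineConnections.

(** * Connections induced on a lightlike hypersurface *)

Section Hypersurface.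
Variables (R : realType) (n : nat) (Mb : manifold R n.+2) (M : manifold R n.+1).
Variables (g : bilinear_field Mb) (i : M -> Mb) (S : M -> set (dvec M)).
Hypotheses (gM : semi_riemannian g) (iM : immersion i).

Lemma Rad_linear : fiber_linear (Rad g i).
Proof.
move=> p a u v [tu [tdu nu]] [tv [tdv nv]]; split; first exact: tangent_lin.
rewrite differential_lin; split; first exact: tangent_lin.
move=> w tw; have tdw := differential_tangent (proj1 iM) tw.
by rewrite (metric_linear gM) // nu // nv // mulr0 addr0.
Qed.

Lemma distribution_linear r (E : M -> set (dvec M)) :
  Defs.distribution r E -> fiber_linear E.
Proof.
move=> dE p a u v; have [W [e [_ Wp _ /(_ p Wp) [-> _]]]] := dE p.
move=> [c _ <-] [d _ <-]; exists (fun k => a * c k + d k) => //.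
rewrite scaler_sumr -big_split /=; apply: eq_bigr => k _.
by rewrite scalerDl scalerA.
Qed.

(** Pairing with [xi] isolates the coefficient of [N]: the radical is orthogonal to all tangent
    directions and [N] pairs to 1 with [xi]. Once [b = c], injectivity of the differential gives
    [u = v]. *)
Lemma transversal_uniq U xi N p (u v : dvec M) (b c : R) :
    radical_section g i U xi -> null_transversal g i S U xi N -> U p ->
    tangent p u -> tangent p v ->
    differential i p u + b *: N p = differential i p v + c *: N p ->
  u = v.
Proof.
move=> hxi hN Up tu tv E; have [iS inj] := iM.
suff bc : b = c by apply: (inj p) => //; move: E; rewrite bc => /addIr.
have tw := tangent_lin (-1) tv tu.
(* The multiple [(c - b) *: N p] is split to fit the form [a *: u + v] of [metric_linear]. *)
have wN : differential i p (-1 *: v + u) = (c - b - 1) *: N p + N p.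
  have du : differential i p u = differential i p v + (c *: N p - b *: N p).
    by rewrite addrA -E addrK.
  by rewrite differential_lin scaleN1r du addKr !scalerBl scale1r subrK.
have [_ /(_ p Up) [txi [tdxi nxi]]] := xi_section hxi.
have tN : tangent (i p) (N p).
  by case: (transversal_field hN) => tN _; exact: tN.
have := nxi _ tw; rewrite (Defs.metric_sym gM) //; last first.
  exact: differential_tangent.
rewrite wN (metric_linear gM) // (transversal_xi hN) // mulr1 subrK.
by move/eqP; rewrite subr_eq0 => /eqP.
Qed.

Lemma induced_affine nablab nabla :
  induced_connection g i S nablab nabla -> affine_connection nabla.
Proof.
move=> [sec [D [[cD _] gauss]]]; have iS := proj1 iM.
(* Near [p] the domain shrinks to where [xi] and [N] exist, with [B] read at [p] only. Each axiom is
   then proved by writing both sides as tangential part plus multiple of [N] and comparing. *)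
have gaussP W p : open W -> W p -> exists W' B (N : M -> dvec Mb),
    [/\ open W', W' `<=` W, W' p,
        forall X Y, vfield W' X -> vfield W' Y ->
          D X (fun q => differential i q (Y q)) p =
          differential i p (nabla X Y p) + B X Y *: N p
      & forall u v b c, tangent p u -> tangent p v ->
          differential i p u + b *: N p = differential i p v + c *: N p ->
        u = v].
  move=> oW Wp; have [U [xi [N [B [Up hxi hN hB]]]]] := gauss p.
  have oU := xi_open hxi; have oWU := openI oW oU.
  exists (W `&` U), (fun X Y => B X Y p), N; split=> //.
    by move=> X Y vX vY; exact: (hB _ _ _ oWU (@subIsetr _ W U) vX vY).
  by move=> u v b c; exact: transversal_uniq hxi hN Up.
have tn W X Y p : open W -> vfield W X -> vfield W Y -> W p ->
    tangent p (nabla X Y p).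
  by move=> oW vX vY; exact: (vfield_at (sec _ _ _ oW vX vY)).
split=> //.
- move=> W X X' V V' oW vX vX' vV vV' XX' VV' p Wp.
  have [W' [B [N [oW' WW' W'p hB uniq]]]] := gaussP _ _ oW Wp.
  have r Y : vfield W Y -> vfield W' Y by exact: vfield_subset.
  (* The two Gauss decompositions are recombined into ambient derivatives, which agree by locality
     of the pull-back connection. *)
  apply: (uniq _ _ (B X V) (B X' V')); [exact: tn Wp|exact: tn Wp|].
  rewrite -!hB; do ?exact: r.
  apply: (conn_local cD oW vX vX') => //; try exact: differential_vfield.
  by move=> q Wq; rewrite VV'.
- move=> W f X X' V oW Cf vX vX' vV p Wp.
  have [W' [B [N [oW' WW' W'p hB uniq]]]] := gaussP _ _ oW Wp.
  have r Y : vfield W Y -> vfield W' Y by exact: vfield_subset.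
  have vXX' := vfield_lin oW Cf vX vX'.
  (* The second coefficient is the normal part obtained by expanding the pull-back derivative
     linearly. *)
  apply: (uniq _ _ (B (fun q => f q *: X q + X' q) V) (f p * B X V + B X' V)).
  + exact: tn vXX' vV Wp.
  + by apply: tangent_lin; [exact: tn vX vV Wp|exact: tn vX' vV Wp].
  rewrite -hB; do ?exact: r.
  rewrite (conn_linear cD oW Cf vX vX' (differential_vfield iS oW vV) Wp).
  rewrite !hB; do ?exact: r.
  by rewrite differential_lin scalerDr scalerDl scalerA addrACA.
- move=> W X V V' oW vX vV vV' p Wp.
  have [W' [B [N [oW' WW' W'p hB uniq]]]] := gaussP _ _ oW Wp.
  have r Y : vfield W Y -> vfield W' Y by exact: vfield_subset.
  have vVV' := vfieldD oW vV vV'.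
  apply: (uniq _ _ (B X (fun q => V q + V' q)) (B X V + B X V')).
  + exact: tn vX vVV' Wp.
  + rewrite -[nabla X V p]scale1r.
    by apply: tangent_lin; [exact: tn vX vV Wp|exact: tn vX vV' Wp].
  rewrite -hB; do ?exact: r.
  under [X in D _ X]eq_fun do rewrite differentialD.
  rewrite (conn_additive cD oW vX (differential_vfield iS oW vV)
    (differential_vfield iS oW vV') Wp) !hB; do ?exact: r.
  by rewrite differentialD scalerDl addrACA.
- move=> W f X V oW Cf vX vV p Wp.
  have [W' [B [N [oW' WW' W'p hB uniq]]]] := gaussP _ _ oW Wp.
  have r Y : vfield W Y -> vfield W' Y by exact: vfield_subset.
  have vfV := vfieldZ oW Cf vV.
  have tV := vfield_at vV Wp; have tXV := tn _ _ _ _ oW vX vV Wp.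
  have tfXV : tangent p (f p *: nabla X V p).
    exact: (vfield_at (vfieldZ oW Cf (sec _ _ _ oW vX vV)) Wp).
  (* The extra Leibniz term is a multiple of [V], hence tangential, and contributes nothing to the
     coefficient of [N]. *)
  apply: (uniq _ _ (B X (fun q => f q *: V q)) (f p * B X V)).
  + exact: tn vX vfV Wp.
  + exact: tangent_lin.
  rewrite -hB; do ?exact: r.
  under [X in D _ X]eq_fun do rewrite differentialZ.
  rewrite (conn_leibniz cD oW Cf vX (differential_vfield iS oW vV) Wp).
  rewrite hB; do ?exact: r.
  by rewrite differential_lin differentialZ scalerDr scalerA addrA.
Qed.

(** [P] is given only by where [P p v] and [v - P p v] lie. The difference of [u] and [P p (u + w)]
    is both screen and radical, so directness of the sum makes it zero. *)
Lemma screen_projectionD (P : M -> dvec M -> dvec M) p (u w : dvec M) :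
    screen_distribution g i S -> screen_projection g i S P ->
    tangent p (u + w) -> S p u -> Rad g i p w ->
  P p (u + w) = u.
Proof.
move=> hS hP tv Su Rw; have lS := distribution_linear (screen_dist hS).
have SP := proj_screen hP tv; have RP := proj_radical hP tv.
apply/esym/eqP; rewrite -subr_eq0; apply/eqP/(screen_direct hS (p := p)).
  exact: fiber_linearB.
rewrite (_ : u - _ = (u + w - P p (u + w)) - w); last by rewrite addrAC addrK.
exact: (fiber_linearB Rad_linear).
Qed.

Lemma curvature_screen_projection (P : M -> dvec M -> dvec M) D W X Y Z p :
    screen_distribution g i S -> screen_projection g i S P ->
    affine_connection D -> parallel D S -> parallel D (Rad g i) ->
    open W -> vfield W X -> vfield W Y -> vfield W Z -> W p ->
  curvature D X Y (fun q => P q (Z q)) p = P p (curvature D X Y Z p).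
Proof.
move=> hS hP aD pS pR oW vX vY vZ Wp.
have lS := distribution_linear (screen_dist hS).
have vP := proj_smooth hP oW vZ; have vQ := vfieldB oW vZ vP.
have sP : dsection S W (fun q => P q (Z q)).
  by split=> // q Wq; apply: (proj_screen hP); exact: vfield_at vZ Wq.
have sQ : dsection (Rad g i) W (fun q => Z q - P q (Z q)).
  by split=> // q Wq; apply: (proj_radical hP); exact: vfield_at vZ Wq.
have [v1 S1] := dsection_curvature lS pS oW vX vY sP.
have [v2 R2] := dsection_curvature Rad_linear pR oW vX vY sQ.
have := curvatureD aD oW vX vY vP vQ Wp.
under [X in curvature _ _ _ X]eq_fun do rewrite addrC subrK.
(* The curvature of the screen part stays in [S] and that of the radical part in the radical, so [P]
   retains exactly the first. *)
move=> ->; rewrite screen_projectionD //; [|exact: S1|exact: R2].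
exact: (vfield_at (vfieldD oW v1 v2) Wp).
Qed.

Lemma weingarten_parallel D U xi A tau W X p :
    screen_distribution g i S -> radical_section g i U xi ->
    weingarten S D U xi A tau -> parallel D (Rad g i) ->
    open W -> W `<=` U -> vfield W X -> W p ->
  D X xi p = - tau p (X p) *: xi p.
Proof.
move=> hS [oU [vxi Rxi] _] hW pR oW WU vX Wp; have Up := WU _ Wp.
have sxi : dsection (Rad g i) W xi.
  by split=> [|q /WU]; [exact: vfield_subset vxi|exact: Rxi].
have [_ /(_ p Wp) RD] := pR _ _ _ oW vX sxi.
have E := weingarten_formula hW oW WU vX Wp.
suff A0 : A p (X p) = 0 by rewrite E A0 oppr0 add0r scaleNr.
apply: (screen_direct hS (p := p)).
  by apply: (weingarten_screen hW) => //; exact: vfield_at vX Wp.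
(* Solving the Weingarten formula for the shape operator exhibits it as a difference of radical
   vectors, [D X xi] being radical by parallelism. *)
have -> : A p (X p) = - tau p (X p) *: xi p - D X xi p.
  by rewrite E opprB opprK scaleNr addKr.
apply: (fiber_linearB Rad_linear) => //.
by apply: (fiber_linearZ _ Rad_linear); exact: Rxi.
Qed.

End Hypersurface.

(** * Curvature of the two induced connections and of their mean *)

Theorem theorem3p10 (R : realType) (n : nat)
    (Mb : manifold R n.+2) (g : bilinear_field Mb)
    (nablab nablabs : connection Mb)
    (hMb : statistical_manifold g nablab nablabs)
    (M : manifold R n.+1) (i : M -> Mb)
    (hM : lightlike_hypersurface g i)
    (S : M -> set (dvec M)) (hS : screen_distribution g i S)
    (P : M -> dvec M -> dvec M) (hP : screen_projection g i S P)
    (nabla nablas : connection M)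
    (hnabla : induced_connection g i S nablab nabla)
    (hnablas : induced_connection g i S nablabs nablas)
    (U : set M) (xi : vec_field M) (hxi : radical_section g i U xi)
    (A As : M -> dvec M -> dvec M) (tau taus : M -> dvec M -> R)
    (htau : weingarten S nabla U xi A tau)
    (htaus : weingarten S nablas U xi As taus)
    (hRad : parallel nabla (Rad g i)) (hRads : parallel nablas (Rad g i))
    (hSc : parallel nabla S) (hScs : parallel nablas S) :
  let nabla0 := mean_connection nabla nablas in
  [/\ (forall (W : set M) (X Y Z : vec_field M), open W ->
         vfield W X -> vfield W Y -> vfield W Z -> forall p, W p ->
         [/\ curvature nabla X Y (fun q => P q (Z q)) p
               = P p (curvature nabla X Y Z p),
             curvature nablas X Y (fun q => P q (Z q)) p
               = P p (curvature nablas X Y Z p)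
           & curvature nabla0 X Y (fun q => P q (Z q)) p
               = P p (curvature nabla0 X Y Z p)]),
      (forall (W : set M) (X Y : vec_field M), open W -> W `<=` U ->
         vfield W X -> vfield W Y -> forall p, W p ->
         [/\ curvature nabla X Y xi p = - (2 * ext_d tau X Y p) *: xi p,
             curvature nablas X Y xi p = - (2 * ext_d taus X Y p) *: xi p
           & curvature nabla0 X Y xi p
               = - (ext_d tau X Y p + ext_d taus X Y p) *: xi p]),
      [/\ curvature_preserves nabla S, curvature_preserves nablas S
        & curvature_preserves nabla0 S]
    & [/\ curvature_preserves nabla (Rad g i),
          curvature_preserves nablas (Rad g i)
        & curvature_preserves nabla0 (Rad g i)]].
Proof.
have gM := stat_metric hMb; have iM := proj1 hM.
have aD := induced_affine gM iM hnabla.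
have aDs := induced_affine gM iM hnablas.
have lS := distribution_linear (screen_dist hS).
have lR : fiber_linear (Rad g i) by exact: Rad_linear.
move=> nabla0; have aD0 : affine_connection nabla0 by exact: mean_affine.
have pS0 : parallel nabla0 S by exact: mean_parallel.
have pR0 : parallel nabla0 (Rad g i) by exact: mean_parallel.
split.
- by move=> W X Y Z oW vX vY vZ p Wp; split;
    apply: (curvature_screen_projection gM iM hS hP _ _ _ oW).
- move=> W X Y oW WU vX vY p Wp.
  have vxi : vfield W xi by apply: vfield_subset WU _; case: (xi_section hxi).
  have Dxi V : vfield W V -> forall q, W q ->
      nabla V xi q = - tau q (V q) *: xi q.
    move=> vV q.
    exact: (weingarten_parallel gM iM hS hxi htau hRad oW WU vV).
  have Dsxi V : vfield W V -> forall q, W q ->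
      nablas V xi q = - taus q (V q) *: xi q.
    move=> vV q.
    exact: (weingarten_parallel gM iM hS hxi htaus hRads oW WU vV).
  have Ct V : vfield W V -> smooth_on W (fun q => tau q (V q)).
    exact: (one_form_smooth (weingarten_form htau) oW WU).
  have Cts V : vfield W V -> smooth_on W (fun q => taus q (V q)).
    exact: (one_form_smooth (weingarten_form htaus) oW WU).
  (* Curvature is quadratic in the connection, so that of the mean is not in general the mean of the
     curvatures. The recurrence is therefore established for [nabla0] itself, with this form. *)
  pose tau0 q v := 2^-1 * (tau q v + taus q v).
  have Ct0 V : vfield W V -> smooth_on W (fun q => tau0 q (V q)).
    move=> vV; apply: smooth_on_scale => //.
    by apply: smooth_onD => //; [exact: Ct|exact: Cts].
  have D0xi V : vfield W V -> forall q, W q ->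
      nabla0 V xi q = - tau0 q (V q) *: xi q.
    move=> vV q Wq; rewrite /nabla0 /mean_connection Dxi // Dsxi //.
    by rewrite -scalerDl scalerA -opprD mulrN.
  split.
  + by apply: (curvature_recurrent aD oW) => //; exact: Ct.
  + by apply: (curvature_recurrent aDs oW) => //; exact: Cts.
  + rewrite (curvature_recurrent aD0 oW vX vY vxi _ _ D0xi) //; try exact: Ct0.
    rewrite (ext_d_mean oW) //; do ?[exact: Ct|exact: Cts].
    (* The factor 2 of the recurrence formula cancels the 1/2 in [tau0], leaving the plain sum of
       the exterior derivatives. *)
    by rewrite mulrA divff ?mul1r // pnatr_eq0.
- by split=> W X Y Z oW vX vY sZ; apply: dsection_curvature.
- by split=> W X Y Z oW vX vY sZ; apply: dsection_curvature.
Qed.
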